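(* Let $W$ be the graph defined below, and let $W_1$ be the graph obtained from a copy $W_0$ of $W$ by replacing each of the three edges $uz$, $ux_1$, $ut$ of $W_0$ with a distinct copy of $W$, where the vertices $u$ and $v$ of that copy are identified with the two endpoints of the edge. Then the fractional arboricity of $W_1$ is $a_f(W_1)=2+\frac{2}{25}$.
   Context: $W$ is the graph on the ten vertices $u,v,w,z,t,x_1,x_2,x_3,x_4,x_5$ with the $24$ edges $wx_1,wx_2,wx_3,wx_4,wx_5$; $x_1x_2,x_2x_3,x_3x_4,x_4x_5,x_5x_1$; $zx_2,zx_3,zu,zv$; $tx_4,tx_5,tu,tv$; $ux_1,ux_2,ux_5,uv$; $vx_3,vx_4$ (it is a planar triangulation). The fractional arboricity $a_f(G)$ of a graph $G$ is the minimum of $p/q$ over positive integers $p,q$ such that one can assign to each vertex a set of $q$ colors from $\{1,\dots,p\}$ so that for each color the set of vertices receiving it induces a forest (acyclic subgraph). *)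

(* Defs.v *)
From HB Require Import structures.
From mathcomp Require Import all_boot all_order all_algebra.

Set Implicit Arguments.
Unset Strict Implicit.
Unset Printing Implicit Defensive.

Import Order.TTheory GRing.Theory Num.Theory.

(* A finite simple graph is a symmetric irreflexive relation on a finType. *)

Definition induces_forest (T : finType) (e : rel T) (A : {set T}) : Prop :=
  forall c : seq T, {subset c <= A} -> 2 < size c -> ~ ucycle e c.

Definition forest_coloring (T : finType) (e : rel T) (p q : nat)
    (c : T -> {set 'I_p}) : Prop :=
  (forall x : T, #|c x| = q) /\
  (forall i : 'I_p, induces_forest e [set x | i \in c x]).

Definition forest_colorable (T : finType) (e : rel T) (p q : nat) : Prop :=
  exists c : T -> {set 'I_p}, forest_coloring e q c.

Definition is_frac_arboricity (T : finType) (e : rel T) (a : rat) : Prop :=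
  (exists p q : nat, [/\ 0 < p, 0 < q, forest_colorable e p q
                       & a = (p%:R / q%:R)%R]) /\
  (forall p q : nat, 0 < p -> 0 < q -> forest_colorable e p q ->
     (a <= p%:R / q%:R)%R).

Inductive Wvertex := Wu | Wv | Ww | Wz | Wt | Wx1 | Wx2 | Wx3 | Wx4 | Wx5.

Definition Wvertex_seq : seq Wvertex :=
  [:: Wu; Wv; Ww; Wz; Wt; Wx1; Wx2; Wx3; Wx4; Wx5].

Definition Wvertex_nat (x : Wvertex) : nat :=
  match x with
  | Wu => 0 | Wv => 1 | Ww => 2 | Wz => 3 | Wt => 4
  | Wx1 => 5 | Wx2 => 6 | Wx3 => 7 | Wx4 => 8 | Wx5 => 9
  end.

Lemma Wvertex_natK : cancel Wvertex_nat (nth Wu Wvertex_seq).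
Proof. by case. Qed.

HB.instance Definition _ := Countable.copy Wvertex (can_type Wvertex_natK).

Lemma Wvertex_seqP : Finite.axiom Wvertex_seq.
Proof. by case. Qed.

HB.instance Definition _ := isFinite.Build Wvertex Wvertex_seqP.

Definition W_edges : seq (Wvertex * Wvertex) :=
  [:: (Ww, Wx1); (Ww, Wx2); (Ww, Wx3); (Ww, Wx4); (Ww, Wx5);
      (Wx1, Wx2); (Wx2, Wx3); (Wx3, Wx4); (Wx4, Wx5); (Wx5, Wx1);
      (Wz, Wx2); (Wz, Wx3); (Wz, Wu); (Wz, Wv);
      (Wt, Wx4); (Wt, Wx5); (Wt, Wu); (Wt, Wv);
      (Wu, Wx1); (Wu, Wx2); (Wu, Wx5); (Wu, Wv);
      (Wv, Wx3); (Wv, Wx4)].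

Definition W : rel Wvertex :=
  fun x y => ((x, y) \in W_edges) || ((y, x) \in W_edges).

Lemma W_sym : symmetric W.
Proof. by move=> x y; rewrite /W orbC. Qed.

Lemma W_irr : irreflexive W.
Proof. by case. Qed.

(* Replacing k edges of a graph e on T by copies of a graph h on H: the i-th
   replaced edge joins (ends i).1 to (ends i).2, and in the i-th copy of h the
   vertices a and b are identified with (ends i).1 and (ends i).2. *)
Section ReplaceEdges.
Variables (T : finType) (e : rel T) (H : finType) (h : rel H) (a b : H).
Variables (k : nat) (ends : 'I_k -> T * T).

Definition inner : finType := {x : H | (x != a) && (x != b)}.

Definition repl_vertex : finType := (T + 'I_k * inner)%type.

Definition in_copy (i : 'I_k) (x : H) : repl_vertex :=
  if insub x is Some y then inr (i, y : inner)
  else if x == a then inl (ends i).1 else inl (ends i).2.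

Definition replaced (x y : T) : bool :=
  [exists i, (ends i == (x, y)) || (ends i == (y, x))].

Definition repl_edges : rel repl_vertex := fun p q =>
  [exists x, exists y, [&& e x y, ~~ replaced x y, p == inl x & q == inl y]]
  || [exists i, exists x, exists y,
        [&& h x y, p == in_copy i x & q == in_copy i y]].

End ReplaceEdges.

Arguments repl_edges {T} e {H} h a b {k} ends.

(* The two ways of identifying the vertices u, v of a copy with the endpoints
   of the edge it replaces need not give isomorphic graphs, as no automorphism
   of W swaps u and v (they have degrees 6 and 5).  For the i-th of the edges
   uz, ux1, ut, v is identified with z, x1, t respectively when flip i is
   false, and with u when flip i is true. *)
Definition W1_ends (flip : 'I_3 -> bool) (i : 'I_3) : Wvertex * Wvertex :=
  let y := tnth [tuple Wz; Wx1; Wt] i in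
  if flip i then (y, Wu) else (Wu, y).

Definition W1 (flip : 'I_3 -> bool) :=
  repl_edges W W Wu Wv (W1_ends flip).

Lemma W1_sym flip : symmetric (W1 flip).
Proof.
suff sub p q : W1 flip p q -> W1 flip q p by move=> p q; apply/idP/idP; apply: sub.
case/orP.
  case/existsP=> x /existsP[y /and4P[exy nr px qy]].
  apply/orP; left; apply/existsP; exists y; apply/existsP; exists x.
  rewrite W_sym exy px qy /= andbT; apply: contra nr => /existsP[i].
  by rewrite orbC => ?; apply/existsP; exists i.
case/existsP=> i /existsP[x /existsP[y /and3P[exy px qy]]].
apply/orP; right; apply/existsP; exists i; apply/existsP; exists y.
by apply/existsP; exists x; rewrite W_sym exy px qy.
Qed.

Lemma W1_irr flip : irreflexive (W1 flip).
Proof.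
move=> p; apply/negP; case/orP.
  case/existsP=> x /existsP[y /and4P[exy _ /eqP-> /eqP[xy]]].
  by rewrite xy W_irr in exy.
case/existsP=> i /existsP[x /existsP[y /and3P[exy /eqP-> /eqP eq_c]]].
have d : (W1_ends flip i).1 != (W1_ends flip i).2.
  by rewrite /W1_ends; case: (flip i); case: i {eq_c} => -[|[|[|]]].
suff xy : x = y by rewrite xy W_irr in exy.
move: eq_c; rewrite /in_copy.
case: insubP => [x' _ <-|nx]; case: insubP => [y' _ <-|ny].
- by case=> ->.
- by case: ifP.
- by case: ifP.
move: nx ny; rewrite !negb_and !negbK.
case: (eqVneq x Wu) => [->|_] /=; case: (eqVneq y Wu) => [->|_] //=.
- by move=> _ _ [] E; rewrite E eqxx in d.
- by move=> _ _ [] E; rewrite E eqxx in d.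
by move=> /eqP-> /eqP->.
Qed.

(* Main.v *)
Require Import Defs.
From mathcomp Require Import all_boot all_order all_algebra.
From mathcomp Require Import perm zify.

Set Implicit Arguments.
Unset Strict Implicit.
Unset Printing Implicit Defensive.

Import Order.TTheory GRing.Theory Num.Theory.

(* Every induced forest F of W satisfies |F| + [u, v in F] <= 5 and
   2|F| + 2[u in F] <= 10 + [u, z in F] + [u, x1 in F] + [u, t in F].  Summed
   over the p colour classes of a colouring with q colours per vertex, the first
   bound, applied to the three copies, says that u shares at most 5p - 10q
   colours with each of z, x1, t; the second, applied to W_0, then gives
   22q <= 10p + 3(5p - 10q), that is 52q <= 25p.

   Conversely, the replaced edges remain present in W_1, so W_1 is obtained by
   gluing W_0 and the copies along edges.  Gluing forests along a clique creates
   no cycle, hence colourings of W_0 and of the copies can be glued once they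
   agree on the replaced edges.  Up to a permutation of the colours, this only
   takes equal numbers of shared colours on these edges, and W has colourings
   with p = 52 and q = 25 in which u shares 10 colours with each of z, x1, t,
   and others in which u shares 10 colours with v. *)

Lemma uniq_prev_next (T : eqType) (c : seq T) (x : T) :
  uniq c -> 2 < size c -> x \in c -> uniq [:: prev c x; x; next c x].
Proof.
move=> c_uniq c_gt2 xc.
have next2_neq : next c (next c x) != x.
  have [i s def_s] := rot_to xc.
  move: c_gt2 c_uniq (c_uniq).
  rewrite -{1}(size_rot i) -{1}(rot_uniq i) => s_gt2 s_uniq c_uniq.
  rewrite -!(next_rot i c_uniq).
  move: s_gt2 s_uniq; rewrite def_s.
  case: s {def_s} => [|y [|z s]] //= _; rewrite !inE !negb_or eqxx.
  case/andP=> /and3P[xy xz _] _.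
  by rewrite [y == x]eq_sym (negPf xy) eqxx eq_sym.
have next_neq : next c x != x by apply: contraNneq next2_neq => nx; rewrite !nx.
have prev_neq : prev c x != x.
  by apply: contraNneq next_neq => {1}<-; rewrite next_prev.
rewrite /= !inE negb_or prev_neq [x == _]eq_sym next_neq !andbT /=.
by apply: contraNneq next2_neq => <-; rewrite next_prev.
Qed.

(* An excursion outside [P] leaves from [K] and returns to [K], so cutting it
   off costs a jump within [K]. *)
Lemma path_filter (T : Type) (e : rel T) (P K : pred T) (x : T) (s : seq T) :
    symmetric e -> (forall y z, P y -> ~~ P z -> e y z -> K y) ->
    P x -> path e x s ->
  path [rel y z | e y z || K y && K z] x (filter P s).
Proof.
move=> e_sym exitK.
suff from_last y : (if P x then y = x else K y) -> path e x s ->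
    path [rel y z | e y z || K y && K z] y (filter P s).
  by move=> Px; apply: from_last; rewrite Px.
elim: s x y => //= z s IHs x y last_y /andP[xz zs].
case: ifPn last_y => [Px -> | nPx Ky]; case: ifPn => [Pz | nPz] /=.
- by rewrite xz (IHs z) ?Pz.
- by apply: (IHs z) => //; rewrite (negPf nPz); apply: exitK xz.
- by rewrite Ky (exitK z x) ?orbT ?(IHs z) ?Pz // e_sym.
- by apply: (IHs z) => //; rewrite (negPf nPz).
Qed.

Lemma cycle_filter (T : eqType) (e : rel T) (P K : pred T) (c : seq T) :
    symmetric e -> (forall y z, P y -> ~~ P z -> e y z -> K y) ->
    cycle e c ->
  cycle [rel y z | e y z || K y && K z] (filter P c).
Proof.
move=> e_sym exitK c_cycle.
have [/hasP[x xc Px] | ] := boolP (has P c); last first.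
  by rewrite has_filter negbK => /eqP->.
case/splitPr: xc c_cycle => c1 c2.
rewrite -(rot_cycle (size c1)) rot_size_cat /= => /(path_filter e_sym exitK Px).
rewrite filter_cat -(rot_cycle (size (filter P c1))) rot_size_cat /= Px /=.
by rewrite -filter_cat filter_rcons Px.
Qed.

Fixpoint subseqs (T : Type) (s : seq T) : seq (seq T) :=
  if s is x :: s' then map (cons x) (subseqs s') ++ subseqs s' else [:: [::]].

Lemma filter_in_subseqs (T : eqType) (P : pred T) (s : seq T) :
  filter P s \in subseqs s.
Proof.
elim: s => //= x s IHs; rewrite mem_cat; case: (P x); last by rewrite IHs orbT.
by rewrite map_f.
Qed.

(** * Induced forests *)

Section InducedForest.
Variables (T : finType) (e : rel T).
Implicit Types (A B : {set T}) (s : seq T).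

Lemma induces_forestS A B :
  A \subset B -> induces_forest e B -> induces_forest e A.
Proof. by move=> /subsetP AB forestB c cA; apply: forestB => x /cA/AB. Qed.

Lemma forest_path_neighbor A x w y :
    induces_forest e A -> {subset x :: w <= A} -> uniq (x :: w) ->
    path (fun z t => e t z) x w -> e x y -> y \in w ->
  y = head x w.
Proof.
move=> forestA sub_w uniq_w path_w xy /splitPr def_w.
case: def_w sub_w uniq_w path_w => -[//|z w1] w2 sub_w uniq_w path_w.
pose c := x :: rcons (z :: w1) y.
have split_w : x :: (z :: w1) ++ y :: w2 = c ++ w2 by rewrite -cat_rcons.
rewrite {}split_w in sub_w uniq_w; case: (forestA (rev c)).
- by move=> t; rewrite mem_rev => tc; apply: sub_w; rewrite mem_cat tc.
- by rewrite size_rev /= size_rcons.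
move: uniq_w path_w; rewrite cat_uniq -cat_rcons cat_path.
case/andP=> uniq_c _ /andP[path_c _].
rewrite /ucycle rev_cycle rev_uniq uniq_c andbT.
by rewrite /cycle /c rcons_path path_c last_rcons xy.
Qed.

Lemma forest_path_extend s x w :
    irreflexive e -> uniq s -> induces_forest e [set y in s] ->
    {subset x :: w <= s} -> uniq (x :: w) -> path (fun y z => e z y) x w ->
    1 < count (e x) s ->
  exists2 y, (y \in s) && (y \notin x :: w) & e x y.
Proof.
move=> e_irr s_uniq forest_s sub_w uniq_w path_w degree_gt1.
apply/exists_inP; apply: contraLR degree_gt1.
rewrite negb_exists_in => /forall_inP no_exit; rewrite -leqNgt -size_filter.
apply: (uniq_leq_size (s2 := [:: head x w]) (filter_uniq _ s_uniq)) => y.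
rewrite mem_filter inE => /andP[xy ys]; apply/eqP.
apply: (forest_path_neighbor forest_s _ uniq_w path_w xy).
  by move=> z /sub_w; rewrite inE.
have : y \in x :: w by apply: contraLR xy => yw; rewrite no_exit ?ys.
by rewrite inE => /predU1P[yx|//]; rewrite yx e_irr in xy.
Qed.

Lemma forest_has_low_degree s :
    irreflexive e -> uniq s -> s != [::] -> induces_forest e [set x in s] ->
  has (fun x => count (e x) s <= 1) s.
Proof.
move=> e_irr s_uniq s_neq0 forest_s; apply: contraT => /hasPn degree_gt1.
have long_path n : exists x w, [/\ {subset x :: w <= s}, uniq (x :: w),
    path (fun y z => e z y) x w & size w = n].
  elim: n => [|n [x [w [sub_w uniq_w path_w <-]]]].
    case: s s_neq0 {s_uniq forest_s degree_gt1} => // x s _.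
    by exists x, [::]; split=> // z; rewrite !inE => ->.
  have x_gt1 : 1 < count (e x) s by rewrite ltnNge degree_gt1 ?sub_w ?mem_head.
  have [y /andP[ys yw] xy] :=
    forest_path_extend e_irr s_uniq forest_s sub_w uniq_w path_w x_gt1.
  exists y, (x :: w); split; rewrite /= ?yw ?xy //.
  by move=> z; rewrite inE => /predU1P[->|/sub_w].
have [x [w [sub_w uniq_w _ size_w]]] := long_path (size s).
by have := uniq_leq_size uniq_w sub_w; rewrite /= size_w ltnn.
Qed.

(* A round of pruning takes something away from any nonempty forest, but nothing
   from a cycle. *)
Definition prune s : seq T := [seq x <- s | 1 < count (e x) s].
Definition acyclic s : bool := iter (size s) prune s == [::].

Lemma size_prune_lt s :
    irreflexive e -> uniq s -> s != [::] -> induces_forest e [set x in s] ->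
  size (prune s) < size s.
Proof.
move=> e_irr s_uniq s_neq0 forest_s.
rewrite size_filter ltn_neqAle count_size andbT -all_count -has_predC.
apply: sub_has (forest_has_low_degree e_irr s_uniq s_neq0 forest_s) => x /=.
by rewrite leqNgt.
Qed.

Lemma forest_acyclic s :
  irreflexive e -> uniq s -> induces_forest e [set x in s] -> acyclic s.
Proof.
move=> e_irr s_uniq forest_s.
suff pruned n t : size t <= n -> uniq t -> induces_forest e [set x in t] ->
    iter n prune t = [::] by apply/eqP/pruned.
elim: n t => [[]|n IHn t size_t t_uniq forest_t] //.
rewrite iterSr; apply: IHn; last 2 first.
- exact: filter_uniq.
- apply: induces_forestS forest_t; apply/subsetP => x.
  by rewrite !inE mem_filter => /andP[].
have [->//|t_neq0] := eqVneq t [::].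
by rewrite -ltnS (leq_trans (size_prune_lt e_irr t_uniq t_neq0 forest_t)).
Qed.

Lemma acyclic_forest s :
  symmetric e -> acyclic s -> induces_forest e [set x in s].
Proof.
move=> e_sym /eqP pruned c sub_c c_gt2 /andP[c_cycle c_uniq].
have keep t : {subset c <= t} -> {subset c <= prune t}.
  move=> ct x xc; rewrite mem_filter ct // andbT -size_filter.
  have /andP[] := uniq_prev_next c_uniq c_gt2 xc.
  rewrite !inE negb_or => /andP[_ prev_next] _.
  apply: (@uniq_leq_size _ [:: prev c x; next c x]).
    by rewrite /= inE prev_next.
  move=> y; rewrite mem_filter !inE => /orP[] /eqP->.
    by rewrite e_sym prev_cycle // ct // mem_prev.
  by rewrite next_cycle // ct // mem_next.
have: {subset c <= iter (size s) prune s}.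
  by elim: (size s) => [x /sub_c|n /keep //]; rewrite inE.
rewrite pruned; case: c c_gt2 {sub_c c_cycle c_uniq keep} => // x c _.
by move/(_ x (mem_head x c)).
Qed.

Lemma forest_acyclic_subseqs A s (Q : pred (seq T)) :
    irreflexive e -> uniq s ->
    all Q [seq t <- subseqs s | acyclic t] ->
  induces_forest e A -> Q [seq x <- s | x \in A].
Proof.
move=> e_irr s_uniq /allP Q_acyclic forestA.
apply: Q_acyclic; rewrite mem_filter filter_in_subseqs andbT.
apply: forest_acyclic => //; first exact: filter_uniq.
apply: induces_forestS forestA; apply/subsetP => x.
by rewrite inE mem_filter => /andP[].
Qed.

End InducedForest.

(* A cycle leaving [Q] enters some [P i]; cutting off its excursions outside
   [P i] leaves a cycle, since they start and end in the clique [P i :&: Q]. *)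
Lemma induces_forest_clique_sum (T I : finType) (e : rel T) (A Q : {set T})
    (P : I -> {set T}) :
    symmetric e ->
    A \subset Q :|: \bigcup_i P i ->
    (forall i x y, x \in P i :\: Q -> e x y -> y \in P i) ->
    (forall i, {in P i :&: Q &, forall x y, x != y -> e x y}) ->
    induces_forest e (A :&: Q) ->
    (forall i, induces_forest e (A :&: P i)) ->
  induces_forest e A.
Proof.
move=> e_sym coverA nbrP cliquePQ forestQ forestP c cA c_gt2 c_ucycle.
have [/allP cQ | /allPn[x xc /= xQ]] := boolP (all (fun x => x \in Q) c).
  by apply: (forestQ c) => // y yc; rewrite inE cA //; apply: cQ.
have [i _ xP] : exists2 i, true & x \in P i.
  by have := subsetP coverA x (cA x xc); rewrite inE (negPf xQ) => /bigcupP.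
have c_uniq := ucycle_uniq c_ucycle; have c_cycle := ucycle_cycle c_ucycle.
set cP := [seq y <- c | y \in P i].
have cP_uniq : uniq cP by apply: filter_uniq.
have cP_gt2 : 2 < size cP.
  apply: (uniq_leq_size (uniq_prev_next c_uniq c_gt2 xc)) => y.
  rewrite mem_filter !inE.
  case/or3P=> /eqP->; rewrite ?mem_prev ?mem_next xc andbT //.
    by apply: (nbrP i x); rewrite ?inE ?xQ // e_sym prev_cycle.
  by apply: (nbrP i x); rewrite ?inE ?xQ // next_cycle.
have exitQ y z : y \in P i -> z \notin P i -> e y z -> y \in P i :&: Q.
  move=> yP zP yz; rewrite inE yP /=; apply: contraNT zP => yQ.
  by apply: nbrP yz; rewrite inE yQ.
have jump_cycle :
    cycle [rel y z | e y z || (y \in P i :&: Q) && (z \in P i :&: Q)] cP.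
  exact: cycle_filter e_sym exitQ c_cycle.
apply: (forestP i cP) => // [y|].
  by rewrite mem_filter inE => /andP[-> /cA ->].
rewrite /ucycle cP_uniq andbT; apply: cycle_from_next => // y yP.
have y_neq_next : y != next cP y.
  by have /and3P[_] := uniq_prev_next cP_uniq cP_gt2 yP; rewrite inE.
have /orP[//|/andP[yK nextK]] := next_cycle jump_cycle yP.
exact: (cliquePQ i).
Qed.

Section ForestTransfer.
Variables (T T' : finType) (e : rel T) (e' : rel T') (f : T -> T').

Lemma induces_forest_preimset (A : {set T'}) :
  injective f -> {homo f : x y / e x y >-> e' x y} ->
  induces_forest e' A -> induces_forest e (f @^-1: A).
Proof.
move=> f_inj f_hom forestA c cA c_gt2 /andP[c_cycle c_uniq].
apply: (forestA (map f c)); rewrite ?size_map //.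
  by move=> _ /mapP[x /cA xA ->]; rewrite inE in xA.
apply/andP; split; last by rewrite map_inj_uniq.
by rewrite cycle_map; apply: sub_cycle c_cycle => x y /f_hom.
Qed.

Lemma induces_forest_setI_codom (A : {set T'}) :
  (forall x y, e' (f x) (f y) -> e x y) ->
  induces_forest e (f @^-1: A) -> induces_forest e' (A :&: f @: setT).
Proof.
move=> f_refl forestA c' c'A.
have [c cA ->] : exists2 c, {subset c <= f @^-1: A} & c' = map f c.
  elim: c' c'A => [|y c' IHc'] c'A; first by exists [::].
  have /setIP[yA /imsetP[x _ def_y]] := c'A y (mem_head y c').
  have [z zc'|c cA ->] := IHc'; first by rewrite c'A // inE zc' orbT.
  exists (x :: c); last by rewrite def_y.
  by move=> z; rewrite inE => /predU1P[->|/cA //]; rewrite inE -def_y.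
rewrite size_map => c_gt2 /andP[c_cycle c_uniq].
apply: (forestA c) => //; rewrite /ucycle (map_uniq c_uniq) andbT.
by move: c_cycle; rewrite cycle_map; apply: sub_cycle => x y /f_refl.
Qed.

End ForestTransfer.

(** * Replacing edges by copies of a graph *)

Section ReplaceEdges.
Variables (T : finType) (e : rel T) (H : finType) (h : rel H) (a b : H).
Variables (k : nat) (ends : 'I_k -> T * T).
Hypotheses (e_sym : symmetric e) (e_irr : irreflexive e).
Hypotheses (h_sym : symmetric h) (h_irr : irreflexive h).
Hypotheses (h_ab : h a b) (e_ends : forall i, e (ends i).1 (ends i).2).

Local Notation inc := (in_copy a b ends).
Local Notation G := (repl_edges e h a b ends).

Let a_neq_b : a != b.
Proof. by apply: contraTneq h_ab => ->; rewrite h_irr. Qed.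

Lemma in_copy_a i : inc i a = inl (ends i).1.
Proof. by rewrite /in_copy insubF ?eqxx. Qed.

Lemma in_copy_b i : inc i b = inl (ends i).2.
Proof. by rewrite /in_copy insubF ?eqxx ?andbF // eq_sym (negPf a_neq_b). Qed.

Lemma in_copy_val i (y : inner a b) : inc i (val y) = inr (i, y).
Proof. by rewrite /in_copy valK. Qed.

Variant in_copy_spec (i : 'I_k) (x : H) : repl_vertex T a b k -> Type :=
  | InCopyA of x = a : in_copy_spec i x (inl (ends i).1)
  | InCopyB of x = b : in_copy_spec i x (inl (ends i).2)
  | InCopyInner (y : inner a b) of x = val y : in_copy_spec i x (inr (i, y)).

Lemma in_copyP i x : in_copy_spec i x (inc i x).
Proof.
rewrite /in_copy; case: insubP => [y _ <-|]; first exact: InCopyInner.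
rewrite negb_and !negbK; case: eqVneq => [-> _|_ /= /eqP->].
  exact: InCopyA.
exact: InCopyB.
Qed.

Lemma in_copy_inj i : injective (inc i).
Proof.
have ends_neq : (ends i).1 != (ends i).2.
  by apply: contraTneq (e_ends i) => ->; rewrite e_irr.
move=> x y.
case: (in_copyP i x) => [->|->|x' ->]; case: (in_copyP i y) => [->|->|y' ->] //.
- by case=> eq_ends; rewrite eq_ends eqxx in ends_neq.
- by case=> eq_ends; rewrite eq_ends eqxx in ends_neq.
by case=> ->.
Qed.

Lemma in_copy_hom i : {homo inc i : x y / h x y >-> G x y}.
Proof.
move=> x y hxy; apply/orP; right; apply/existsP; exists i.
by apply/existsP; exists x; apply/existsP; exists y; rewrite hxy !eqxx.
Qed.

Lemma repl_edges_sym : symmetric G.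
Proof.
suff sub p q : G p q -> G q p by move=> p q; apply/idP/idP; apply: sub.
case/orP=> [/existsP[x /existsP[y /and4P[exy not_replaced /eqP-> /eqP->]]]|].
  apply/orP; left; apply/existsP; exists y; apply/existsP; exists x.
  rewrite e_sym exy !eqxx !andbT; apply: contra not_replaced.
  by case/existsP=> i; rewrite orbC => ?; apply/existsP; exists i.
case/existsP=> i /existsP[x /existsP[y /and3P[hxy /eqP-> /eqP->]]].
by rewrite in_copy_hom // h_sym.
Qed.

Lemma repl_edges_inl x y : G (inl x) (inl y) = e x y.
Proof.
apply/idP/idP.
  case/orP; first by case/existsP=> ? /existsP[? /and4P[? _ /eqP[->] /eqP[->]]].
  case/existsP=> i /existsP[x' /existsP[y' /and3P[]]].
  case: in_copyP => [->|->|? _] //; case: in_copyP => [->|->|? _] //.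
  - by rewrite h_irr.
  - by move=> _ /eqP[->] /eqP[->].
  - by move=> _ /eqP[->] /eqP[->]; rewrite e_sym.
  by rewrite h_irr.
move=> exy; have [|not_replaced] := boolP (replaced ends x y); last first.
  apply/orP; left; apply/existsP; exists x; apply/existsP; exists y.
  by rewrite exy not_replaced !eqxx.
case/existsP=> i; have := in_copy_hom i h_ab.
rewrite in_copy_a in_copy_b => Gi.
by case/orP=> /eqP Ei; rewrite Ei // repl_edges_sym in Gi *.
Qed.

Lemma repl_edges_inr i y q :
  G (inr (i, y)) q -> exists2 x, q = inc i x & h (val y) x.
Proof.
case/orP; first by case/existsP=> x' /existsP[y' /and4P[]].
case/existsP=> j /existsP[x /existsP[x' /and3P[]]].
case: (in_copyP j x) => // y' -> hxx' /eqP[-> ->] /eqP->.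
by exists x'.
Qed.

Lemma repl_edges_in_copy i x y : G (inc i x) (inc i y) = h x y.
Proof.
apply/idP/idP; last exact: in_copy_hom.
have from_inner (x' : inner a b) z : G (inr (i, x')) (inc i z) -> h (val x') z.
  by case/repl_edges_inr=> _ /in_copy_inj <-.
case: (in_copyP i x) => [->|->|x' ->]; last exact: from_inner.
- case: (in_copyP i y) => [->|->|y' ->] //.
    by rewrite repl_edges_inl e_irr.
  by rewrite repl_edges_sym h_sym -in_copy_a; apply: from_inner.
case: (in_copyP i y) => [->|->|y' ->]; first by rewrite h_sym.
  by rewrite repl_edges_inl e_irr.
by rewrite repl_edges_sym h_sym -in_copy_b; apply: from_inner.
Qed.

Lemma induces_forest_repl_edges (A : {set repl_vertex T a b k}) :
  induces_forest e (inl @^-1: A) ->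
  (forall i, induces_forest h (inc i @^-1: A)) -> induces_forest G A.
Proof.
move=> forest_base forest_copy.
apply: (@induces_forest_clique_sum _ _ _ _ (inl @: setT)
          (fun i => inc i @: setT)) repl_edges_sym _ _ _ _ _.
- apply/subsetP=> -[x _|[i y] _]; rewrite inE; first by rewrite imset_f.
  apply/orP; right; apply/bigcupP; exists i => //.
  by rewrite -in_copy_val imset_f.
- move=> i p q /setDP[/imsetP[x _ ->]]; case: in_copyP => [_|_|y _ _].
  + by rewrite imset_f.
  + by rewrite imset_f.
  by case/repl_edges_inr=> z -> _; rewrite imset_f.
- move=> i p q /setIP[/imsetP[x _ ->] xT] /setIP[/imsetP[y _ ->] yT].
  rewrite (inj_eq (@in_copy_inj i)) repl_edges_in_copy.
  have boundary z : inc i z \in inl @: setT -> z = a \/ z = b.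
    by case: in_copyP => [||? _ /imsetP[]//]; [left | right].
  have [[-> | ->] [-> | ->]] := (boundary x xT, boundary y yT);
    by rewrite ?eqxx // h_sym.
- apply: induces_forest_setI_codom forest_base => x y.
  by rewrite repl_edges_inl.
- move=> i; apply: induces_forest_setI_codom (forest_copy i) => x y.
  by rewrite repl_edges_in_copy.
Qed.

End ReplaceEdges.

(** * Forest colourings *)

Definition color_class (T : finType) (p : nat) (c : T -> {set 'I_p}) (i : 'I_p)
    : {set T} := [set x | i \in c x].

Lemma preimset_color_class (T T' : finType) (p : nat) (c : T' -> {set 'I_p})
    (f : T -> T') (i : 'I_p) :
  f @^-1: color_class c i = color_class (c \o f) i.
Proof. by apply/setP=> x; rewrite !inE. Qed.

Lemma forest_coloring_comp (T T' : finType) (e : rel T) (e' : rel T')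
    (p q : nat) (c : T' -> {set 'I_p}) (f : T -> T') :
  injective f -> {homo f : x y / e x y >-> e' x y} ->
  forest_coloring e' q c -> forest_coloring e q (c \o f).
Proof.
move=> f_inj f_hom [c_card c_forest]; split=> [x|i]; first exact: c_card.
rewrite -[X in induces_forest _ X]preimset_color_class.
exact: induces_forest_preimset (c_forest i).
Qed.

Lemma exists_perm_comp (S : eqType) (p : nat) (f g : 'I_p -> S) :
  perm_eq (codom f) (codom g) -> exists s : 'S_p, forall i, f (s i) = g i.
Proof.
have codomE (u : 'I_p -> S) : codom u = [tuple u i | i < p].
  by rewrite /= codomE.
rewrite [codom f]codomE [codom g]codomE perm_sym => /tuple_permP[s eq_gf].
exists s => i; have /(congr1 (fun t => tnth t i)) := val_inj eq_gf.
by rewrite !tnth_map !tnth_ord_tuple.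
Qed.

Lemma count_codom_mem2 (I : finType) (A B : {set I}) (y : bool * bool) :
  count_mem y (codom (fun i => (i \in A, i \in B))) =
    match y with
    | (true, true) => #|A :&: B|
    | (true, false) => #|A| - #|A :&: B|
    | (false, true) => #|B| - #|A :&: B|
    | (false, false) => #|I| - (#|A| + #|B| - #|A :&: B|)
    end.
Proof.
transitivity #|[set i | (i \in A, i \in B) == y]|.
  by rewrite -sum1_count big_image_cond sum1dep_card.
case: y => -[] []; last rewrite -cardsU -[A :|: B]setCK -cardsCs.
all: rewrite -?cardsD 1?[A :&: B]setIC -?cardsD; apply: eq_card => i.
all: by rewrite !inE xpair_eqE; case: (i \in A); case: (i \in B).
Qed.

Lemma exists_perm_preimset2 (p : nat) (A B A' B' : {set 'I_p}) :
    #|A| = #|A'| -> #|B| = #|B'| -> #|A :&: B| = #|A' :&: B'| ->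
  exists s : 'S_p, s @^-1: A = A' /\ s @^-1: B = B'.
Proof.
move=> cardA cardB cardAB.
have [s sP] : exists s : 'S_p,
    forall i, (s i \in A, s i \in B) = (i \in A', i \in B').
  apply: (@exists_perm_comp _ _ (fun i => (i \in A, i \in B))).
  by apply/allP => y _ /=; rewrite !count_codom_mem2 cardA cardB cardAB.
by exists s; split; apply/setP => i; rewrite inE; case: (sP i).
Qed.

(* Permuting the colours of a copy makes it agree with [c] on the edge that it
   replaces. *)
Lemma repl_edges_forest_colorable (T : finType) (e : rel T) (H : finType)
    (h : rel H) (a b : H) (k : nat) (ends : 'I_k -> T * T) (p q : nat)
    (c : T -> {set 'I_p}) (d : H -> {set 'I_p}) :
    symmetric e -> irreflexive e -> symmetric h -> irreflexive h ->
    h a b -> (forall i, e (ends i).1 (ends i).2) ->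
    forest_coloring e q c -> forest_coloring h q d ->
    (forall i, #|c (ends i).1 :&: c (ends i).2| = #|d a :&: d b|) ->
  forest_colorable (repl_edges e h a b ends) p q.
Proof.
move=> e_sym e_irr h_sym h_irr h_ab e_ends [c_card c_forest] [d_card d_forest].
move=> eq_shared.
have recolor i : exists s : 'S_p,
    s @^-1: d a = c (ends i).1 /\ s @^-1: d b = c (ends i).2.
  by apply: exists_perm_preimset2; rewrite ?c_card ?d_card.
have [s sP] := fin_all_exists recolor.
pose c1 (x : repl_vertex T a b k) :=
  match x with inl x => c x | inr (i, y) => s i @^-1: d (val y) end.
have c1_copy i x : c1 (in_copy a b ends i x) = s i @^-1: d x.
  by have [sa sb] := sP i; case: in_copyP => [->|->|y ->].
exists c1; split=> [[x|[i y]]|j] /=; first exact: c_card.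
  by rewrite card_preimset ?d_card //; apply: perm_inj.
apply: (induces_forest_repl_edges e_sym e_irr h_sym h_irr h_ab e_ends) => [|i].
  rewrite [X in induces_forest _ X]preimset_color_class; exact: c_forest.
have -> : in_copy a b ends i @^-1: [set x | j \in c1 x] = color_class d (s i j).
  by apply/setP=> x; rewrite !inE c1_copy inE.
exact: d_forest.
Qed.

Lemma sum_mem_card (I : finType) (A : {set I}) :
  \sum_i (i \in A : nat) = #|A|.
Proof.
by rewrite -sum1_card [RHS]big_mkcond; apply: eq_bigr => i _; case: ifP.
Qed.

Section ColorCounting.
Variables (T : finType) (p : nat) (c : T -> {set 'I_p}).

Lemma sum_card_color_class :
  \sum_(i < p) #|color_class c i| = \sum_x #|c x|.
Proof.
under eq_bigr do rewrite -sum_mem_card.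
rewrite exchange_big; apply: eq_bigr => x _; rewrite -sum_mem_card.
by apply: eq_bigr => i _; rewrite inE.
Qed.

Lemma sum_mem_color_class (x : T) :
  \sum_(i < p) (x \in color_class c i : nat) = #|c x|.
Proof. by rewrite -sum_mem_card; apply: eq_bigr => i _; rewrite inE. Qed.

Lemma sum_mem2_color_class (x y : T) :
  \sum_(i < p) ((x \in color_class c i) && (y \in color_class c i) : nat) =
    #|c x :&: c y|.
Proof. by rewrite -sum_mem_card; apply: eq_bigr => i _; rewrite !inE. Qed.

End ColorCounting.

Definition class_coloring (T : finType) (p : nat) (L : p.-tuple (seq T)) (x : T)
    : {set 'I_p} := [set i | x \in tnth L i].

Section ClassColoring.
Variables (T : finType) (p : nat) (L : p.-tuple (seq T)).

Lemma card_class_coloring x :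
  #|class_coloring L x| = count (fun s => x \in s) L.
Proof. by rewrite -sum1dep_card -sum1_count big_tuple. Qed.

Lemma card_class_coloringI x y :
  #|class_coloring L x :&: class_coloring L y| =
    count (fun s => (x \in s) && (y \in s)) L.
Proof.
rewrite -sum1_count big_tuple sum1dep_card.
by apply: eq_card => i; rewrite !inE.
Qed.

Lemma class_coloring_forest (e : rel T) (q : nat) :
    symmetric e -> (forall x, count (fun s => x \in s) L = q) ->
    all (acyclic e) L ->
  forest_coloring e q (class_coloring L).
Proof.
move=> e_sym Lq /all_tnthP L_acyclic; split=> [x|i].
  by rewrite card_class_coloring.
have -> : [set x | i \in class_coloring L x] = [set x in tnth L i].
  by apply/setP=> x; rewrite !inE.
exact: acyclic_forest (L_acyclic i).
Qed.

End ClassColoring.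

Lemma is_frac_arboricity_ratio (T : finType) (e : rel T) (m n : nat) :
    0 < m -> 0 < n -> forest_colorable e m n ->
    (forall p q, forest_colorable e p q -> m * q <= n * p) ->
  is_frac_arboricity e (m%:R / n%:R)%R.
Proof.
move=> m_gt0 n_gt0 colorable_mn bound; split; first by exists m, n.
move=> p q p_gt0 q_gt0 /bound le_mn.
rewrite ler_pdivlMr ?ltr0n // mulrAC ler_pdivrMr ?ltr0n // -!natrM ler_nat.
by rewrite [p * n]mulnC.
Qed.

(** * The graph [W] *)

Lemma mem_Wvertex_filter (A : {set Wvertex}) x :
  (x \in [seq y <- Wvertex_seq | y \in A]) = (x \in A).
Proof. by rewrite mem_filter; case: x; rewrite andbT. Qed.

Lemma card_Wvertex_set (A : {set Wvertex}) :
  #|A| = size [seq x <- Wvertex_seq | x \in A].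
Proof.
rewrite cardE; apply/perm_size/uniq_perm; rewrite ?enum_uniq ?filter_uniq //.
by move=> x; rewrite mem_enum mem_Wvertex_filter.
Qed.

Lemma card_Wvertex : #|{: Wvertex}| = 10.
Proof. by rewrite -cardsT card_Wvertex_set /= !inE. Qed.

Lemma W_forest_bound_uv (A : {set Wvertex}) : induces_forest W A ->
  #|A| + ((Wu \in A) && (Wv \in A)) <= 5.
Proof.
move=> forestA; rewrite card_Wvertex_set -!(mem_Wvertex_filter A).
pose Q s := size s + ((Wu \in s) && (Wv \in s)) <= 5.
apply: (forest_acyclic_subseqs (s := Wvertex_seq) (Q := Q) W_irr) forestA.
  by [].
by vm_compute.
Qed.

Lemma W_forest_bound_u (A : {set Wvertex}) : induces_forest W A ->
  2 * (#|A| + (Wu \in A)) <= 10 + ((Wu \in A) && (Wz \in A)) +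
    ((Wu \in A) && (Wx1 \in A)) + ((Wu \in A) && (Wt \in A)).
Proof.
move=> forestA; rewrite card_Wvertex_set -!(mem_Wvertex_filter A).
pose Q s := 2 * (size s + (Wu \in s)) <= 10 + ((Wu \in s) && (Wz \in s)) +
  ((Wu \in s) && (Wx1 \in s)) + ((Wu \in s) && (Wt \in s)).
apply: (forest_acyclic_subseqs (s := Wvertex_seq) (Q := Q) W_irr) forestA.
  by [].
by vm_compute.
Qed.

Lemma W_coloring_bound_uv (p q : nat) (c : Wvertex -> {set 'I_p}) :
  forest_coloring W q c -> 10 * q + #|c Wu :&: c Wv| <= 5 * p.
Proof.
case=> c_card c_forest.
have := leq_sum (index_enum 'I_p) (fun i (_ : xpredT i) =>
  W_forest_bound_uv (c_forest i : induces_forest W (color_class c i))).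
rewrite big_split /= sum_card_color_class sum_mem2_color_class.
rewrite (eq_bigr _ (fun x _ => c_card x)) !sum_nat_const card_Wvertex card_ord.
by rewrite [p * 5]mulnC.
Qed.

Lemma W_coloring_bound_u (p q : nat) (c : Wvertex -> {set 'I_p}) :
  forest_coloring W q c ->
  22 * q <= 10 * p + #|c Wu :&: c Wz| + #|c Wu :&: c Wx1| + #|c Wu :&: c Wt|.
Proof.
case=> c_card c_forest.
have := leq_sum (index_enum 'I_p) (fun i (_ : xpredT i) =>
  W_forest_bound_u (c_forest i : induces_forest W (color_class c i))).
rewrite -big_distrr !big_split /= sum_card_color_class !sum_mem2_color_class.
rewrite sum_mem_color_class (eq_bigr _ (fun x _ => c_card x)) !sum_nat_const.
rewrite card_Wvertex card_ord c_card.
by rewrite -mulSnr mulnA [p * 10]mulnC.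
Qed.

(** * The graph [W1] *)

Lemma W1_ends_adj flip i : W (W1_ends flip i).1 (W1_ends flip i).2.
Proof. by rewrite /W1_ends; case: (flip i); case: i => -[|[|[|]]]. Qed.

Lemma W1_coloring_bound flip (p q : nat) :
  forest_colorable (W1 flip) p q -> 52 * q <= 25 * p.
Proof.
case=> c c_col; have ends_adj := W1_ends_adj flip.
have shared i : 10 * q +
    #|c (inl (W1_ends flip i).1) :&: c (inl (W1_ends flip i).2)| <= 5 * p.
  have copy_inj : injective (in_copy Wu Wv (W1_ends flip) i).
    exact: (in_copy_inj W_irr ends_adj).
  have copy_hom :
    {homo in_copy Wu Wv (W1_ends flip) i : x y / W x y >-> W1 flip x y}.
    exact: in_copy_hom.
  have := W_coloring_bound_uv (forest_coloring_comp copy_inj copy_hom c_col).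
  by rewrite /= in_copy_a (in_copy_b _ W_irr).
have shared_u i : 10 * q +
    #|c (inl Wu) :&: c (inl (tnth [tuple Wz; Wx1; Wt] i))| <= 5 * p.
  by have := shared i; rewrite /W1_ends; case: (flip i) => //=; rewrite setIC.
have inl_hom : {homo inl : x y / W x y >-> W1 flip x y}.
  by move=> x y xy; rewrite /W1 (repl_edges_inl W_sym W_sym W_irr).
have := W_coloring_bound_u (forest_coloring_comp inl_inj inl_hom c_col).
move: (shared_u (inord 0)) (shared_u (inord 1)) (shared_u (inord 2)).
by rewrite !(tnth_nth Wu) /= !inordK //=; lia.
Qed.

(* Integer solutions of the linear programs dual to [W_forest_bound_u] and
   [W_forest_bound_uv], in which [u] shares 10 colours with each of [z], [x1],
   [t], respectively with [v]. *)
Definition base_classes : 52.-tuple (seq Wvertex) :=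
  [tuple of nseq 3 [:: Ww; Wt; Wx1; Wx3; Wz] ++
            nseq 9 [:: Wu; Wv; Wx4; Ww] ++
            nseq 5 [:: Wu; Wz; Wt; Wx4; Ww] ++
            nseq 5 [:: Wu; Wz; Wx1; Wx3; Wx4] ++
            nseq 5 [:: Wu; Wt; Wx1; Wx4; Wx3] ++
            nseq 4 [:: Wv; Wz; Wt; Wx2; Wx5] ++
            nseq 8 [:: Ww; Wx2; Wz; Wx5; Wt] ++
            nseq 12 [:: Wv; Wx3; Wx2; Wx1; Wx5] ++
            nseq 1 [:: Wu; Wx2; Wx5; Wx4]].

Definition copy_classes : 52.-tuple (seq Wvertex) :=
  [tuple of nseq 6 [:: Wu; Wv; Wx2; Ww] ++
            nseq 11 [:: Wu; Wz; Wt; Wx3; Ww] ++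
            nseq 2 [:: Wu; Wz; Wx1; Ww; Wx4] ++
            nseq 2 [:: Wu; Wt; Wx1; Wx4; Wx3] ++
            nseq 6 [:: Wz; Wx1; Wx3; Wx4; Wt] ++
            nseq 4 [:: Wu; Wv; Wx2; Wx5] ++
            nseq 6 [:: Ww; Wx3; Wz; Wx5; Wt] ++
            nseq 15 [:: Wv; Wx4; Wx5; Wx1; Wx2]].

Lemma base_coloring : forest_coloring W 25 (class_coloring base_classes).
Proof. by apply: class_coloring_forest W_sym _ _ => [[]|]; vm_compute. Qed.

Lemma copy_coloring : forest_coloring W 25 (class_coloring copy_classes).
Proof. by apply: class_coloring_forest W_sym _ _ => [[]|]; vm_compute. Qed.

Lemma W1_colorable flip : forest_colorable (W1 flip) 52 25.
Proof.
apply: (repl_edges_forest_colorable W_sym W_irr W_sym W_irr _ (W1_ends_adj flip)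
          base_coloring copy_coloring) => // i.
rewrite !card_class_coloringI /W1_ends.
by case: (flip i); case: i => -[|[|[|]]] //= lt_i; vm_compute.
Qed.

Theorem theorem5 (flip : 'I_3 -> bool) :
  is_frac_arboricity (W1 flip) (2 + 2 / 25)%R.
Proof.
have -> : (2 + 2 / 25 = 52%:R / 25%:R :> rat)%R by [].
apply: is_frac_arboricity_ratio => //; first exact: W1_colorable.
exact: W1_coloring_bound.
Qed.
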